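(* Let $E$ be a nonzero real Banach space and $S\colon E\rightrightarrows E^*$ be closed, monotone and quasidense. Then: (i) whenever $w\in E$ and $\widetilde W$ is a nonempty $w(E^*,E)$-compact convex subset of $E^*$ such that $\max_{x^*\in\widetilde W}\langle s-w,s^*-x^*\rangle\ge0$ for all $(s,s^* )\in G(S)$, we have $S(w)\cap\widetilde W\ne\emptyset$; (ii) whenever $W$ is a nonempty $w(E,E^* )$-compact convex subset of $E$ and $w^*\in E^*$ are such that $\max_{x\in W}\langle s-x,s^*-w^*\rangle\ge0$ for all $(s,s^* )\in G(S)$, we have $w^*\in S(W)=\bigcup_{x\in W}S(x)$.
   Context: For a multifunction $S\colon E\rightrightarrows E^*$ with nonempty graph $G(S)$: closed means $G(S)$ norm-closed; monotone means $\langle s-t,s^*-t^*\rangle\ge0$ on $G(S)$; quasidense means for every $(x,x^* )\in E\times E^*$, $\inf_{(s,s^* )\in G(S)}[\tfrac12\|s-x\|^2+\tfrac12\|s^*-x^*\|^2+\langle s-x,s^*-x^*\rangle]\le0$. *)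

(* Defs.v *)
From HB Require Import structures.
From mathcomp Require Import all_boot all_order all_algebra.
From mathcomp Require Import all_classical all_reals all_analysis.
Set Implicit Arguments. Unset Strict Implicit. Unset Printing Implicit Defensive.
Import Order.TTheory GRing.Theory Num.Theory.
Import numFieldNormedType.Exports.
Local Open Scope classical_set_scope.
Local Open Scope ring_scope.

Section Defs.
Context {R : realType} {E : normedModType R}.

Definition is_dual (f : E -> R) : Prop :=
  (forall (a : R) (x y : E), f (a *: x + y) = a * f x + f y) /\ continuous f.

Definition dnorm (f : E -> R) : R := sup [set `|f x| | x in [set x : E | `|x| <= 1]].

Definition fsub (f g : E -> R) : E -> R := fun x => f x - g x.

Definition graph (S : E -> set (E -> R)) : set (E * (E -> R)) :=
  [set p | S p.1 p.2].

Definition into_dual (S : E -> set (E -> R)) : Prop :=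
  forall x xs, S x xs -> is_dual xs.

Definition mf_closed (S : E -> set (E -> R)) : Prop :=
  forall x xs, is_dual xs ->
    (forall e : R, 0 < e -> exists s ss, S s ss /\ `|s - x| < e /\ dnorm (fsub ss xs) < e) ->
    S x xs.

Definition mf_monotone (S : E -> set (E -> R)) : Prop :=
  forall s ss t ts, S s ss -> S t ts -> 0 <= ss (s - t) - ts (s - t).

Definition mf_quasidense (S : E -> set (E -> R)) : Prop :=
  forall x xs, is_dual xs ->
    (ereal_inf [set ((2^-1 * `|p.1 - x| ^+ 2 + 2^-1 * dnorm (fsub p.2 xs) ^+ 2
                      + (p.2 (p.1 - x) - xs (p.1 - x)))%:E)%E
               | p in graph S] <= 0)%E.

Definition convexE (W : set E) : Prop :=
  forall a b, W a -> W b -> forall t : R, 0 <= t <= 1 -> W (t *: a + (1 - t) *: b).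
Definition convex_dual (W : set (E -> R)) : Prop :=
  forall f g, W f -> W g -> forall t : R, 0 <= t <= 1 ->
    W (fun x => t * f x + (1 - t) * g x).

Definition dualT := {f : E -> R | is_dual f}.
Definition weak_top := initial_topology
  (fun x : E => ((fun f : dualT => sval f x) : {ptws dualT -> R})).

Definition weakly_compact (W : set E) : Prop := @compact weak_top W.

(** w(E^*,E)-compactness of a subset of E^*: compactness for the topology of
    pointwise convergence on E (the weak-* topology is the subspace topology
    it induces on E^*, and compactness of a subset is intrinsic). *)
Definition weakstar_compact (W : set (E -> R)) : Prop :=
  @compact {ptws E -> R} W.

End Defs.

(* Main.v *)
(** Write W for the compact convex set, in Y, and X for the other space (X = E,
    Y = E^* in (i), X = E^*, Y = E in (ii)). The hypothesis says that (w, 0) is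
    monotonically related to the sum of S and the subdifferential of
    x |-> max_{z in W} <w - x, z>, so one wants this sum to be quasidense at
    (w, 0). Quasidensity of S at (w, z), for each z in W, is such a statement
    with a point depending on z; the quantity to be minimised is convex in the
    point and affine in z, and W is compact, so a minimax theorem makes the
    point independent of z. The resulting approximate solutions are close to
    points (s, s') of the graph with s close to w and s' close to W, and a
    cluster point in W of the latter is monotonically related to the graph,
    hence in S(w) by maximality. No bidual is involved. *)
Require Import Defs.
From HB Require Import structures.
From mathcomp Require Import all_boot all_order all_algebra.
From mathcomp Require Import all_classical all_reals all_analysis.
From mathcomp Require Import ring lra.
Import Order.TTheory GRing.Theory Num.Theory.
Import numFieldNormedType.Exports.
Local Open Scope classical_set_scope.
Local Open Scope ring_scope.

Set Implicit Arguments.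
Unset Strict Implicit.
Unset Printing Implicit Defensive.

(* Only the second norm is required to be determined by the pairing. *)
Record normed_pairing (R : realType) (X Y : lmodType R) := NormedPairing {
  normX : X -> R;
  normY : Y -> R;
  pair : X -> Y -> R;
  normXD : forall x y, normX (x + y) <= normX x + normX y;
  normXZ : forall a x, normX (a *: x) = `|a| * normX x;
  normYD : forall x y, normY (x + y) <= normY x + normY y;
  normYZ : forall a x, normY (a *: x) = `|a| * normY x;
  pairPl : forall a x x' y, pair (a *: x + x') y = a * pair x y + pair x' y;
  pairPr : forall a x y y', pair x (a *: y + y') = a * pair x y + pair x y';
  pair_le : forall x y, `|pair x y| <= normX x * normY y;
  pair_norming : forall y M, M < normY y ->
    exists2 x, normX x <= 1 & M < pair x y }.

(** Finitely many conditions that persist as d shrinks share one d, the minimum along the list. *)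
Lemma seq_uniform_small (R : realType) (T : eqType) (Q : T -> R -> Prop)
    (l : seq T) :
  (forall p d d', 0 < d' -> d' <= d -> Q p d -> Q p d') ->
  (forall p, p \in l -> exists2 d, 0 < d & Q p d) ->
  exists2 d, 0 < d & forall p, p \in l -> Q p d.
Proof.
move=> Qmono; elim: l => [_|p l IH Ql]; first by exists 1.
have [d d0 Qd] := IH (fun q ql => Ql q (mem_behead (s := p :: l) ql)).
have [e e0 Qe] := Ql p (mem_head _ _).
have m0 : 0 < Num.min d e by rewrite lt_min d0 e0.
exists (Num.min d e) => // q; rewrite inE => /orP[/eqP ->|/Qd].
  by apply: Qmono Qe => //; rewrite ge_min lexx orbT.
by apply: Qmono => //; rewrite ge_min lexx.
Qed.

(** * Minimax for half-space-compact sets *)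

Section Minimax.
Context {R : realType} {X Y : lmodType R} (B : normed_pairing X Y).
Local Notation "[< x , y >]" := (pair B x y).

Lemma pairDl x x' y : [<x + x', y>] = [<x, y>] + [<x', y>].
Proof. by have := pairPl B 1 x x' y; rewrite scale1r mul1r. Qed.
Lemma pairDr x y y' : [<x, y + y'>] = [<x, y>] + [<x, y'>].
Proof. by have := pairPr B 1 x y y'; rewrite scale1r mul1r. Qed.
Lemma pair0l y : [<0, y>] = 0.
Proof. by apply: (addrI [<0, y>]); rewrite -pairDl !addr0. Qed.
Lemma pair0r x : [<x, 0>] = 0.
Proof. by apply: (addrI [<x, 0>]); rewrite -pairDr !addr0. Qed.
Lemma pairZl a x y : [<a *: x, y>] = a * [<x, y>].
Proof. by have := pairPl B a x 0 y; rewrite pair0l !addr0. Qed.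
Lemma pairZr a x y : [<x, a *: y>] = a * [<x, y>].
Proof. by have := pairPr B a x y 0; rewrite pair0r !addr0. Qed.
Lemma pairNl x y : [<- x, y>] = - [<x, y>].
Proof. by rewrite -scaleN1r pairZl mulN1r. Qed.
Lemma pairNr x y : [<x, - y>] = - [<x, y>].
Proof. by rewrite -scaleN1r pairZr mulN1r. Qed.
Definition pairE := (pairDl, pairDr, pairNl, pairNr, pairZl, pairZr).

Lemma normXN x : normX B (- x) = normX B x.
Proof. by rewrite -scaleN1r normXZ normrN1 mul1r. Qed.
Lemma normYN x : normY B (- x) = normY B x.
Proof. by rewrite -scaleN1r normYZ normrN1 mul1r. Qed.
Lemma normX_ge0 x : 0 <= normX B x.
Proof.
have := normXD B x (- x); rewrite normXN subrr -(scale0r (0 : X)) normXZ normr0 mul0r.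
by lra.
Qed.
Lemma normY_ge0 x : 0 <= normY B x.
Proof.
have := normYD B x (- x); rewrite normYN subrr -(scale0r (0 : Y)) normYZ normr0 mul0r.
by lra.
Qed.

Definition convex_lmod {V : lmodType R} (W : set V) : Prop :=
  forall a b, W a -> W b -> forall t : R, 0 <= t <= 1 ->
    W (t *: a + (1 - t) *: b).

(* w(Y, X)-compactness of W, tested on closed half-spaces only. *)
Definition halfspace_compact (W : set Y) : Prop :=
  forall A : set (X * R),
    (forall l : seq (X * R), (forall p, p \in l -> A p) ->
       exists2 y, W y & forall p, p \in l -> p.2 <= [<p.1, y>]) ->
    exists2 y, W y & forall p, A p -> p.2 <= [<p.1, y>].

(** The image of W under (f, g) is a convex planar set missing the quadrant f >= 0, g > 0; a line
    through the origin separates the two. *)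
Lemma two_affine_minimax (W : set Y) (f g : Y -> R) :
  convex_lmod W ->
  (forall t a b, f (t *: a + (1 - t) *: b) = t * f a + (1 - t) * f b) ->
  (forall t a b, g (t *: a + (1 - t) *: b) = t * g a + (1 - t) * g b) ->
  (forall y, W y -> 0 <= f y -> g y <= 0) ->
  exists2 t : R, 0 <= t <= 1 & forall y, W y -> t * g y + (1 - t) * f y <= 0.
Proof.
move=> cW fA gA fg.
have [gle|] := pselect (forall y, W y -> g y <= 0).
  by exists 1 => [|y Wy]; [lra|have := gle y Wy; lra].
move=> /existsNP[b0 /not_implyP[Wb0 /negP]]; rewrite -ltNge => gb0.
(* At the point of the segment from a to b where f vanishes, g is nonpositive; denominators are then
   cleared. *)
have cross a b : W a -> W b -> 0 <= f a -> 0 < g b -> f a * g b <= f b * g a.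
  move=> Wa Wb fa gb.
  have fb : f b < 0 by rewrite ltNge; apply/negP => /(fg _ Wb); lra.
  have fab : 0 < f a - f b by lra.
  pose t := f a / (f a - f b).
  have tE : t * (f a - f b) = f a by rewrite /t divfK// gt_eqF.
  have t01 : 0 <= t <= 1.
    by rewrite /t divr_ge0 ?(ltW fab)//= ler_pdivrMr// mul1r; lra.
  have f0 : f (t *: b + (1 - t) *: a) = 0.
    by rewrite fA; have : t * (f a - f b) = f a by []; lra.
  have := fg _ (cW _ _ Wb Wa t t01); rewrite f0 lexx => /(_ isT).
  rewrite gA => H.
  have : (f a - f b) * (t * g b + (1 - t) * g a) <= 0.
    by rewrite pmulr_rle0.
  have -> : (f a - f b) * (t * g b + (1 - t) * g a) =
    (t * (f a - f b)) * g b + (f a - f b) * g a - (t * (f a - f b)) * g a by ring.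
  by rewrite tE; nra.
(* For g > 0, u * g + f <= 0 means u <= - f / g, so the largest admissible multiplier is the infimum
   of [A]. *)
pose A := [set - f b / g b | b in [set b | W b /\ 0 < g b]].
have A0 : A !=set0 by exists (- f b0 / g b0), b0.
have lbA : lbound A 0.
  move=> _ [b [Wb gb] <-]; apply: divr_ge0; last exact: ltW.
  by rewrite oppr_ge0 leNgt; apply/negP => /ltW/(fg _ Wb); lra.
have iA : has_inf A by split => //; exists 0.
pose u := inf A.
have u0 : 0 <= u by apply: lb_le_inf.
have key y : W y -> u * g y + f y <= 0.
  move=> Wy; have [fy|fy] := leP 0 (f y).
    have gy := fg _ Wy fy.
    have [gy0|gy0] := eqVneq (g y) 0.
      have := cross _ _ Wy Wb0 fy gb0; rewrite gy0 mulr0; nra.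
    have gyN : 0 < - g y by rewrite oppr_gt0 lt_neqAle gy0.
    have : f y / (- g y) <= u.
      apply: lb_le_inf => // _ [b [Wb gb] <-].
      rewrite ler_pdivrMr// mulrAC ler_pdivlMr//.
      by have := cross _ _ Wy Wb fy gb; nra.
    by rewrite ler_pdivrMr//; lra.
  have [gy|gy] := leP (g y) 0; first by nra.
  have : u <= - f y / g y by apply: ge_inf; [exists 0|exists y].
  by rewrite ler_pdivlMr//; lra.
exists (u / (1 + u)).
  by rewrite divr_ge0//= ?ler_pdivrMr; lra.
move=> y Wy.
have u1 : 0 < 1 + u by lra.
have -> : u / (1 + u) * g y + (1 - u / (1 + u)) * f y = (u * g y + f y) / (1 + u).
  by field; rewrite gt_eqF.
by rewrite pmulr_lle0 ?invr_gt0//; exact: key.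
Qed.

Lemma affine_pair (x : X) (c t : R) a b :
  [<x, t *: a + (1 - t) *: b>] - c = t * ([<x, a>] - c) + (1 - t) * ([<x, b>] - c).
Proof. by rewrite !pairE; ring. Qed.

(** A pair (x, c) stands for the affine function <x, y> - c of y. *)
Definition convex_pairs (P : set (X * R)) : Prop :=
  forall p q, P p -> P q -> forall t : R, 0 <= t <= 1 ->
    P (t *: p.1 + (1 - t) *: q.1, t * p.2 + (1 - t) * q.2).

(** Induction on the list: where the first function is nonnegative the others suffice and yield q,
    which [two_affine_minimax] combines with the first function. *)
Lemma finite_minimax (P : set (X * R)) : convex_pairs P ->
  forall (l : seq (X * R)) p0, (forall p, p \in p0 :: l -> P p) ->
  forall W : set Y, convex_lmod W ->
  (forall y, W y -> exists2 p, p \in p0 :: l & [<p.1, y>] < p.2) ->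
  exists2 p, P p & forall y, W y -> [<p.1, y>] <= p.2.
Proof.
move=> cP; elim=> [|p1 l IH] p0 Pl W cW Wl.
  exists p0 => [|y /Wl[p]]; first exact/Pl/mem_head.
  by rewrite inE => /eqP -> /ltW.
have Pp0 : P p0 by apply/Pl/mem_head.
pose W' := [set y | W y /\ 0 <= [<p0.1, y>] - p0.2].
have [|||q Pq W'q] := IH p1 _ W'.
- by move=> p pl; apply: Pl; rewrite in_cons pl orbT.
- move=> a b [Wa pa] [Wb pb] t t01; split; first exact: cW.
  by rewrite affine_pair; nra.
- move=> y [Wy py]; have [p] := Wl y Wy.
  by rewrite inE => /orP[/eqP ->|pl ylt]; [lra|exists p].
have [||||t t01 tle] :=
  @two_affine_minimax W (fun y => [<p0.1, y>] - p0.2) (fun y => [<q.1, y>] - q.2).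
- exact: cW.
- by move=> *; exact: affine_pair.
- by move=> *; exact: affine_pair.
- by move=> y Wy py; have := W'q y (conj Wy py); lra.
exists (t *: q.1 + (1 - t) *: p0.1, t * q.2 + (1 - t) * p0.2); first exact: cP.
by move=> y Wy /=; have := tle y Wy; rewrite !pairE; lra.
Qed.

(** No point of W satisfies all constraints of P, so by compactness a finite list of them already
    has no solution in W. *)
Lemma halfspace_minimax (P : set (X * R)) (W : set Y) :
  W !=set0 -> halfspace_compact W -> convex_lmod W -> convex_pairs P ->
  (forall y, W y -> exists2 p, P p & [<p.1, y>] < p.2) ->
  exists2 p, P p & forall y, W y -> [<p.1, y>] <= p.2.
Proof.
move=> [y0 Wy0] kW cW cP WP.
have [Wfin|] := pselect (forall l : seq (X * R), (forall p, p \in l -> P p) ->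
       exists2 y, W y & forall p, p \in l -> p.2 <= [<p.1, y>]).
  have [y Wy yP] := kW P Wfin.
  by have [p /yP Pp] := WP y Wy; rewrite ltNge Pp.
move=> /existsNP[l /not_implyP[Pl nl]].
have Wl y : W y -> exists2 p, p \in l & [<p.1, y>] < p.2.
  move=> Wy; apply: contrapT => H; apply: nl; exists y => // p pl.
  by rewrite leNgt; apply/negP => ylt; apply: H; exists p.
case: l Pl {nl} Wl => [|p0 l] Pl Wl; first by have [] := Wl y0 Wy0.
exact: (finite_minimax cP Pl cW Wl).
Qed.

(** Otherwise the half-spaces <- x, y> >= c, over all c, would meet finitely many at a time in W,
    while no y lies in all of them. *)
Lemma halfspace_compact_lb (W : set Y) (x : X) :
  W !=set0 -> halfspace_compact W -> exists m, forall y, W y -> - m <= [<x, y>].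
Proof.
move=> W0 kW; apply: contrapT => H.
have unb c : exists2 y, W y & c <= [<- x, y>].
  apply: contrapT => Hc; apply: H; exists c => y Wy.
  rewrite leNgt; apply/negP => ylt; apply: Hc; exists y => //.
  by rewrite !pairE; lra.
have [|y Wy /(_ (- x, [<- x, y>] + 1) erefl)/=] := kW [set p | p.1 = - x]; last by lra.
move=> l lx.
(* A common bound of the levels in [l], written as an inverse so that the condition persists for
   smaller d. *)
have [d d0 dl] : exists2 d : R, 0 < d & forall p, p \in l -> p.2 <= d^-1.
  apply: (@seq_uniform_small R _ (fun p d => p.2 <= d^-1)) => [p d d' d'0 d'd|p _].
    by move=> /le_trans; apply; rewrite lef_pV2// posrE; lra.
  exists ((`|p.2| + 1)^-1); first by rewrite invr_gt0; have := normr_ge0 p.2; lra.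
  by rewrite invrK; have := ler_norm p.2; lra.
have [y Wy yd] := unb d^-1; exists y => // p pl.
by rewrite (lx _ pl); apply: le_trans yd; exact: dl.
Qed.

End Minimax.

(** * Norm boundedness of half-space-compact convex sets *)

Section Boundedness.
Context {R : realType} {X Y : lmodType R} (B : normed_pairing X Y).
Context (W : set Y) (W0 : W !=set0) (kW : halfspace_compact B W).
Context (cW : convex_lmod W).
Local Notation "[< x , y >]" := (pair B x y).

(** Strict inequalities survive a small move of y. *)
Definition satisfies (l : seq (X * R)) (y : Y) :=
  W y /\ forall p, p \in l -> p.2 < [<p.1, y>].

(* Moving from y slightly towards a point of W of huge norm keeps the strict
   constraints and violates any given norm bound. *)
Lemma unbounded_extend (l : seq (X * R)) (y : Y) (c : R) :
  (forall D, exists2 z, W z & D < normY B z) -> satisfies l y ->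
  exists x z, normX B x <= 1 /\ satisfies ((x, c) :: l) z.
Proof.
move=> Wunb [Wy yl].
(* One t serves all z, because each <p.1, z> is bounded below over W. *)
have [t t0 tl] : exists2 t : R, 0 < t & forall p, p \in l ->
    t <= 1 /\ forall z, W z -> p.2 < [<p.1, (t *: z + (1 - t) *: y)>].
  apply: seq_uniform_small => [p d d' d'0 d'd [d1 dP]|p pl].
    split=> [|z Wz]; first lra.
    have := dP z Wz; have := dP y Wy; rewrite !pairE => plt H.
    by have [uv|uv] := leP [<p.1, y>] [<p.1, z>]; nra.
  have [m mP] := halfspace_compact_lb p.1 W0 kW.
  have := yl p pl; set u := [<p.1, y>] => pu.
  have s0 : 0 < `|u| + `|m| + 1 by have := normr_ge0 u; have := normr_ge0 m; lra.
  pose d := Num.min 1 ((u - p.2) / (`|u| + `|m| + 1)).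
  have d0 : 0 < d by rewrite lt_min ltr01 divr_gt0//; lra.
  have d1 : d <= 1 by rewrite ge_min lexx.
  have dle : d * (`|u| + `|m| + 1) <= u - p.2.
    by rewrite -ler_pdivlMr// ge_min lexx orbT.
  exists d => //; split=> // z Wz; rewrite !pairE -/u.
  have := mP z Wz; set v := [<p.1, z>] => mv.
  have := ler_norm u; have := ler_norm m => h1 h2.
  suff : d * (u - v) < u - p.2 by lra.
  apply: lt_le_trans dle; rewrite ltr_pM2l//; lra.
(* Any p in [l] forces t <= 1; the minimum covers the empty list. *)
pose s := Num.min 1 t.
have s0 : 0 < s by rewrite lt_min ltr01.
have s1 : s <= 1 by rewrite ge_min lexx.
have [z Wz zbig] := Wunb ((`|c| + 1 + normY B y) / s).
move: zbig; rewrite ltr_pdivrMr// => zbig.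
pose z' := s *: z + (1 - s) *: y.
have Wz' : W z' by apply: cW => //; rewrite (ltW s0).
have : c < normY B z'.
  have := normYD B z' (- ((1 - s) *: y)); rewrite {1}/z' addrK normYN !normYZ.
  rewrite (gtr0_norm s0) ger0_norm ?subr_ge0//.
  have := ler_norm c; have := normY_ge0 B y; nra.
move=> /(pair_norming (n := B))[x x1 xc].
exists x, z'; split=> //; split=> // p; rewrite inE => /orP[/eqP ->//|pl].
have [t1 tP] := tl p pl.
by rewrite /z' /s (_ : Num.min 1 t = t); [exact: tP|exact/min_idPr].
Qed.

(** Otherwise constraints n < <x_n, y> with |x_n| <= 1 can be added one by one, every stage being
    satisfiable in W; compactness gives y in W with n <= <x_n, y> <= |y| for all n. *)
Lemma halfspace_compact_bounded : exists D, forall y, W y -> normY B y <= D.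
Proof.
apply: contrapT => H.
have Wunb D : exists2 z, W z & D < normY B z.
  apply: contrapT => HD; apply: H; exists D => y Wy.
  by rewrite leNgt; apply/negP => Dy; apply: HD; exists y.
pose state := {q : seq (X * R) * Y | satisfies q.1 q.2}.
have [f fP] : {f : nat -> state -> state | forall n (q : state), exists2 x,
    normX B x <= 1 & (sval (f n q)).1 = (x, n%:R) :: (sval q).1}.
  have H' (nq : nat * state) : {q' : state | exists2 x, normX B x <= 1 &
      (sval q').1 = (x, nq.1%:R) :: (sval nq.2).1}.
    apply: cid; case: nq => n [[l y] ly].
    have [x [z [x1 xz]]] := unbounded_extend n%:R Wunb ly.
    by exists (exist _ ((x, n%:R) :: l, z) xz), x.
  exists (fun n q => sval (H' (n, q))) => n q.
  exact: (svalP (H' (n, q))).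
have [y0 Wy0] := W0.
have s0 : satisfies [::] y0 by [].
pose q := fix q n : state :=
  if n is m.+1 then f m (q m) else exist _ ([::], y0) s0.
pose L n := (sval (q n)).1.
have Lsub m n p : (m <= n)%N -> p \in L m -> p \in L n.
  move=> /subnK <-; elim: (n - m)%N => //= k IH pm.
  have [x _ E] := fP (k + m)%N (q (k + m)%N).
  by rewrite addSn /L /= E in_cons IH// orbT.
have [|y Wy yP] := kW (A := [set p | exists n, p \in L n]).
  move=> l ll.
  have [n nP] : exists n, forall p, p \in l -> p \in L n.
    elim: l ll => [|p l IH] ll; first by exists 0%N.
    have [|n nP] := IH; first by move=> r rl; apply: ll; rewrite in_cons rl orbT.
    have [m mP] := ll p (mem_head _ _).
    exists (maxn m n) => r; rewrite in_cons => /orP[/eqP ->|/nP].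
      by apply: Lsub mP; rewrite leq_maxl.
    by apply: Lsub; rewrite leq_maxr.
  have [Wz zP] := svalP (q n).
  by exists (sval (q n)).2 => // p /nP /zP /ltW.
have big n : n%:R <= normY B y.
  have [x x1 E] := fP n (q n).
  have /yP /= le : exists m, (x, n%:R) \in L m.
    by exists n.+1; rewrite /L /= E mem_head.
  have := pair_le B x y; have := ler_norm [<x, y>].
  by have := normY_ge0 B y; nra.
have := archi_boundP (normY_ge0 B y).
by rewrite ltNge big.
Qed.

End Boundedness.

(** * The abstract theorem for a pairing *)

Section Intersection.
Context {R : realType} {X Y : lmodType R} (B : normed_pairing X Y).
Context (G : X -> Y -> Prop).
Local Notation "[< x , y >]" := (pair B x y).
Context (Gmono : forall s s' t t', G s s' -> G t t' -> 0 <= [<s - t, s' - t'>]).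
Context (Gqd : forall x y (e : R), 0 < e -> exists s s', G s s' /\
  2^-1 * normX B (s - x) ^+ 2 + 2^-1 * normY B (s' - y) ^+ 2 + [<s - x, s' - y>] < e).
Context (Gclosed : forall x y,
  (forall e : R, 0 < e -> exists s s',
     [/\ G s s', normX B (s - x) < e & normY B (s' - y) < e]) -> G x y).

Lemma sq_normX_convex t x x' : 0 <= t <= 1 ->
  normX B (t *: x + (1 - t) *: x') ^+ 2 <=
  t * normX B x ^+ 2 + (1 - t) * normX B x' ^+ 2.
Proof.
move=> t01; have := normXD B (t *: x) ((1 - t) *: x'); rewrite !normXZ.
rewrite !ger0_norm; [|lra..] => H.
apply: (@le_trans _ _ ((t * normX B x + (1 - t) * normX B x') ^+ 2)).
  by rewrite ler_sqr// nnegrE; [exact: normX_ge0|apply: le_trans H; exact: normX_ge0].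
set a := normX B x; set b := normX B x'.
rewrite -subr_ge0 (_ : _ - _ = t * (1 - t) * (a - b) ^+ 2); last by ring.
by rewrite mulr_ge0 ?sqr_ge0// mulr_ge0//; lra.
Qed.

Lemma sq_normY_convex t x x' : 0 <= t <= 1 ->
  normY B (t *: x + (1 - t) *: x') ^+ 2 <=
  t * normY B x ^+ 2 + (1 - t) * normY B x' ^+ 2.
Proof.
move=> t01; have := normYD B (t *: x) ((1 - t) *: x'); rewrite !normYZ.
rewrite !ger0_norm; [|lra..] => H.
apply: (@le_trans _ _ ((t * normY B x + (1 - t) * normY B x') ^+ 2)).
  by rewrite ler_sqr// nnegrE; [exact: normY_ge0|apply: le_trans H; exact: normY_ge0].
set a := normY B x; set b := normY B x'.
rewrite -subr_ge0 (_ : _ - _ = t * (1 - t) * (a - b) ^+ 2); last by ring.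
by rewrite mulr_ge0 ?sqr_ge0// mulr_ge0//; lra.
Qed.

Lemma small_of_monotone x y e s s' : 0 < e ->
  0 <= [<s - x, s' - y>] ->
  2^-1 * normX B (s - x) ^+ 2 + 2^-1 * normY B (s' - y) ^+ 2 + [<s - x, s' - y>]
    < 2^-1 * e ^+ 2 ->
  normX B (s - x) < e /\ normY B (s' - y) < e.
Proof.
move=> e0 p0 lt; have := normX_ge0 B (s - x); have := normY_ge0 B (s' - y).
set a := normX _ _ in lt *; set b := normY _ _ in lt * => b0 a0.
by split; rewrite -ltr_sqr ?nnegrE ?(ltW e0)//; have := sqr_ge0 a; have := sqr_ge0 b; lra.
Qed.

(** The pairing term is nonnegative, so the graph points supplied by quasidensity at (x, y) converge
    to it in norm. *)
Lemma monotone_quasidense_maximal x y :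
  (forall t t', G t t' -> 0 <= [<t - x, t' - y>]) -> G x y.
Proof.
move=> H; apply: Gclosed => e e0.
have [|s [s' [Gs lt]]] := @Gqd x y (2^-1 * e ^+ 2).
  by rewrite mulr_gt0 ?exprn_gt0// invr_gt0.
have [h1 h2] := small_of_monotone e0 (H _ _ Gs) lt.
by exists s, s'.
Qed.

Context (w : X) (W : set Y) (W0 : W !=set0) (kW : halfspace_compact B W).
Context (cW : convex_lmod W).
Context (GW : forall s s', G s s' -> exists2 y, W y & 0 <= [<s - w, s' - y>]).

(** These (x, y, r) form the epigraph of the Fitzpatrick function of G, a supremum that may be
    infinite. *)
Definition above_fitzpatrick (x : X) (y : Y) (r : R) : Prop :=
  forall t t', G t t' -> [<t, y>] + [<x, t'>] - [<t, t'>] <= r.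

(* Quasidensity at (w, z) for each z in W, made uniform in z by the minimax
   theorem: this is the approximate quasidensity at (w, 0) of the sum of G and
   the subdifferential of x |-> max_{z in W} <w - x, z>. *)
Lemma sum_quasidense (e : R) : 0 < e -> exists x y z r,
  [/\ W z, above_fitzpatrick x y r & forall z', W z' ->
  [<w - x, z'>] <= e - r + [<w, y>] - 2^-1 * normX B (x - w) ^+ 2
      - 2^-1 * normY B (y - z) ^+ 2].
Proof.
move=> e0.
(* The bound on the second component is concave in (x, y, z, r), so [P] is convex. *)
pose P := [set p : X * R | exists x y z r, [/\ W z, above_fitzpatrick x y r,
  p.1 = w - x & p.2 <= e - r + [<w, y>] - 2^-1 * normX B (x - w) ^+ 2
      - 2^-1 * normY B (y - z) ^+ 2]].
have [|z Wz|p [x [y [z [r [Wz xyr -> pP]]]]] zP] := halfspace_minimax (P := P) W0 kW cW.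
- move=> [p1 p2] [q1 q2] /= [x [y [z [r [/= Wz F pE pP]]]]].
  move=> [x' [y' [z' [r' [/= Wz' F' pE' pP']]]]] t t01.
  have comb (a b a' b' : R) : a <= b -> a' <= b' ->
      t * a + (1 - t) * a' <= t * b + (1 - t) * b'.
    by move=> ab ab'; rewrite lerD// ler_wpM2l//; lra.
  exists (t *: x + (1 - t) *: x'), (t *: y + (1 - t) *: y'),
    (t *: z + (1 - t) *: z'), (t * r + (1 - t) * r'); split => /=.
  + exact: cW.
  + move=> s s' Gs; rewrite !pairE.
    by have := comb _ _ _ _ (F _ _ Gs) (F' _ _ Gs); lra.
  + rewrite pE pE' !scalerBr opprD addrACA -scalerDl; congr (_ + _).
      by rewrite (_ : t + (1 - t) = 1) ?scale1r//; ring.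
  + have -> : t *: x + (1 - t) *: x' - w = t *: (x - w) + (1 - t) *: (x' - w).
      rewrite !scalerBr addrACA -opprD -scalerDl.
      by rewrite (_ : t + (1 - t) = 1) ?scale1r//; ring.
    have -> : t *: y + (1 - t) *: y' - (t *: z + (1 - t) *: z') =
      t *: (y - z) + (1 - t) *: (y' - z').
      by rewrite !scalerBr opprD addrACA.
    have := sq_normX_convex (x - w) (x' - w) t01.
    have := sq_normY_convex (y - z) (y' - z') t01.
    by have := comb _ _ _ _ pP pP'; rewrite !pairE; lra.
(* For fixed z, the graph point near-optimal at (w, z) serves with r = <s, s'>, which by
   monotonicity lies above the Fitzpatrick function there. *)
- have [s [s' [Gs lt]]] := Gqd w z e0.
  exists (w - s, e - [<s, s'>] + [<w, s'>] - 2^-1 * normX B (s - w) ^+ 2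
      - 2^-1 * normY B (s' - z) ^+ 2) => /=.
    exists s, s', z, [<s, s'>]; split => //= t t' Gt.
    by have := Gmono Gt Gs; rewrite !pairE; lra.
  by move: lt; rewrite !pairE; lra.
exists x, y, z, r; split => // z' /zP /le_trans; exact.
Qed.

(** Let (s, s') be near-optimal for quasidensity at the (x, y) of [sum_quasidense]. Taking z' = z
    gives r - <x, y> <= d^2, so s is near x and s' near y; taking for z' the point that [GW]
    attaches to (s, s') shows x near w and y near z. *)
Lemma near_graph (e : R) : 0 < e -> exists s s' z,
  [/\ G s s', W z, normX B (s - w) <= e & normY B (s' - z) <= e].
Proof.
move=> e0; have [D WD] := halfspace_compact_bounded W0 kW cW.
have D0 : 0 <= D by case: W0 => y /WD; apply: le_trans; exact: normY_ge0.
pose c := 20 + 8 * D.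
have c0 : 0 < c by rewrite /c; lra.
(* The final distances are at most 4 * d + e / 2, and [d * c] is the bound reached in [k4]. *)
pose d := Num.min 1 (Num.min (e / 8) ((e / 2) ^+ 2 / c)).
have d0 : 0 < d.
  rewrite !lt_min ltr01 /=; apply/andP; split; first by rewrite divr_gt0.
  by rewrite divr_gt0// exprn_gt0// divr_gt0.
have d1 : d <= 1 by rewrite ge_min lexx.
have de : d <= e / 8 by rewrite !ge_min lexx orbT.
have dc : d * c <= (e / 2) ^+ 2 by rewrite -ler_pdivlMr// !ge_min lexx !orbT.
have d20 : 0 < d ^+ 2 by rewrite exprn_gt0.
have [x [y [z [r [Wz F zP]]]]] := sum_quasidense d20.
have [s [s' [Gs lt]]] := Gqd x y d20.
have := F _ _ Gs; have := zP z Wz.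
have [z0 Wz0 sz0] := GW Gs; have := zP z0 Wz0.
pose a := normX B (x - w); pose b := normY B (y - z).
pose u := normX B (s - x); pose v := normY B (s' - y).
rewrite -/a -/b in lt *; rewrite -/u -/v in lt.
move=> h0 h1 h2.
have a0 : 0 <= a by exact: normX_ge0.
have b0 : 0 <= b by exact: normY_ge0.
have u0 : 0 <= u by exact: normX_ge0.
have v0 : 0 <= v by exact: normY_ge0.
pose rho := r - [<x, y>].
have nsp : - rho <= [<s - x, s' - y>] by rewrite /rho; move: h2; rewrite !pairE; lra.
have rhoge : - d ^+ 2 < rho by have := sqr_ge0 u; have := sqr_ge0 v; lra.
have ab : - (a * b) <= [<x - w, y - z>].
  by have := pair_le B (x - w) (y - z); rewrite ler_norml => /andP[].
have rhole : rho <= d ^+ 2.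
  have -> : rho = r - [<x, y>] by [].
  have := sqr_ge0 (a - b); rewrite sqrrB.
  by move: ab h1; rewrite !pairE; lra.
have uv : u ^+ 2 + v ^+ 2 <= 4 * d ^+ 2 by lra.
have u2 : u <= 2 * d.
  by rewrite -ler_sqr ?nnegrE// ?exprMn; have := sqr_ge0 v; lra.
have v2 : v <= 2 * d.
  by rewrite -ler_sqr ?nnegrE// ?exprMn; have := sqr_ge0 u; lra.
have sz : normY B (s' - z0) <= 2 * d + b + 2 * D.
  have -> : s' - z0 = (s' - y) + ((y - z) + (z - z0)).
    by rewrite !addrA !subrK.
  have := normYD B (s' - y) ((y - z) + (z - z0)).
  have := normYD B (y - z) (z - z0); have := normYD B z (- z0).
  by rewrite normYN; have := WD _ Wz; have := WD _ Wz0; rewrite -/b -/v; lra.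
have k1 : [<s - x, s' - z0>] <= 2 * d * (2 * d + b + 2 * D).
  apply: le_trans (ler_norm _) _; apply: le_trans (pair_le _ _ _) _.
  by apply: ler_pM => //; exact: normY_ge0.
have k2 : [<x - w, s' - y>] <= a * (2 * d).
  apply: le_trans (ler_norm _) _; apply: le_trans (pair_le _ _ _) _.
  by apply: ler_pM.
(* <w - x, y - z0> is the sum of <x - w, s' - y>, <s - x, s' - z0> and <w - s, s' - z0>; the last is
   nonpositive by the choice of z0. *)
have k3 : 2^-1 * a ^+ 2 + 2^-1 * b ^+ 2 <=
    2 * d ^+ 2 + 2 * d * (2 * d + b + 2 * D) + a * (2 * d).
  move: rhoge h0 k1 k2 sz0; rewrite /rho !pairE; lra.
have k4 : (a - 2 * d) ^+ 2 + (b - 2 * d) ^+ 2 <= d * c.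
  rewrite /c; have : d ^+ 2 <= d by rewrite expr2 ler_piMr// ltW.
  by nra.
have ale : a - 2 * d <= e / 2.
  rewrite leNgt; apply/negP => ea.
  have : (e / 2) ^+ 2 < (a - 2 * d) ^+ 2 by rewrite ltr_sqr// nnegrE; lra.
  by have := sqr_ge0 (b - 2 * d); lra.
have ble : b - 2 * d <= e / 2.
  rewrite leNgt; apply/negP => ea.
  have : (e / 2) ^+ 2 < (b - 2 * d) ^+ 2 by rewrite ltr_sqr// nnegrE; lra.
  by have := sqr_ge0 (a - 2 * d); lra.
exists s, s', z; split => //.
  have := normXD B (s - x) (x - w); rewrite addrA subrK -/u -/a; lra.
have := normYD B (s' - y) (y - z); rewrite addrA subrK -/v -/b; lra.
Qed.

Lemma graph_meets : exists2 z, W z & G w z.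
Proof.
have [D WD] := halfspace_compact_bounded W0 kW cW.
have D0 : 0 <= D by case: W0 => y /WD; apply: le_trans; exact: normY_ge0.
(* The constraint makes (w, z) monotonically related to (t, t') up to e; the slack is needed because
   graph points only approach w and W. *)
pose A := [set p : X * R | exists t t' e, [/\ G t t', 0 < e &
  p = (w - t, [<w - t, t'>] - e)]].
have [l lA|z Wz zA] := kW (A := A).
  have [d d0 dP] : exists2 d : R, 0 < d & forall p, p \in l ->
      forall s s' z, G s s' -> W z -> normX B (s - w) <= d ->
        normY B (s' - z) <= d -> p.2 <= [<p.1, z>].
    apply: seq_uniform_small => [p d d' _ d'd dP s s' z Gs Wz hs hz|p /lA].
      by apply: (dP s s') => //; lra.
    move=> [t [t' [e [Gt e0 ->]]]] /=.
    (* [d * c] bounds the loss in passing from <s - t, s' - t'> to <w - t, z - t'>. *)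
    pose c := normY B t' + D + normX B (t - w) + 1.
    have t0 := normX_ge0 B (t - w); have t0' := normY_ge0 B t'.
    have c0 : 0 < c by rewrite /c; lra.
    pose d := Num.min 1 (e / c).
    have d0 : 0 < d by rewrite lt_min ltr01 divr_gt0.
    have d1 : d <= 1 by rewrite ge_min lexx.
    have dc : d * c <= e by rewrite -ler_pdivlMr// ge_min lexx orbT.
    exists d => // s s' z Gs Wz sw sz.
    have k1 : [<w - s, t' - z>] <= d * (normY B t' + D).
      apply: le_trans (ler_norm _) _; apply: le_trans (pair_le _ _ _) _.
      rewrite -normXN opprB; apply: ler_pM => //; [exact: normX_ge0|exact: normY_ge0|].
      by apply: le_trans (normYD _ _ _) _; rewrite normYN lerD2l; exact: WD.
    have k2 : [<s - t, s' - z>] <= (normX B (t - w) + 1) * d.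
      apply: le_trans (ler_norm _) _; apply: le_trans (pair_le _ _ _) _.
      apply: ler_pM => //; [exact: normX_ge0|exact: normY_ge0|].
      have := normXD B (s - w) (w - t); rewrite addrA subrK.
      by rewrite -(normXN B (w - t)) opprB; lra.
    have k3 := Gmono Gt Gs.
    move: dc k1 k2 k3; rewrite /c !pairE; lra.
  have [s [s' [z [Gs Wz sw sz]]]] := near_graph d0.
  by exists z => // p pl; exact: (dP p pl s s').
exists z => //; apply: monotone_quasidense_maximal => t t' Gt.
rewrite leNgt; apply/negP => lt0.
pose e := - 2^-1 * [<t - w, t' - z>].
have e0 : 0 < e by rewrite /e; lra.
have : A (w - t, [<w - t, t'>] - e) by exists t, t', e.
by move=> /zA /=; rewrite /e; move: lt0; rewrite !pairE; lra.
Qed.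

End Intersection.

(** * Norming functionals and the two pairings of E with its dual *)

Section HahnBanach.
Context {R : realType} {V : lmodType R}.

(** Applying the inequality also to a^-1 gives equality for a > 0. *)
Definition sublinear (p : V -> R) : Prop :=
  (forall x y, p (x + y) <= p x + p y) /\ (forall a x, 0 < a -> p (a *: x) <= a * p x).

Lemma sublinear0 p : sublinear p -> p 0 = 0.
Proof.
move=> [_ ph]; have := ph 2 0 (ltr0Sn _ 1); have := ph 2^-1 0.
by rewrite !scaler0 invr_gt0 => /(_ (ltr0Sn _ 1)); lra.
Qed.

Lemma sublinearZ p a x : sublinear p -> 0 <= a -> p (a *: x) = a * p x.
Proof.
move=> pS; rewrite le_eqVlt => /orP[/eqP <-|a0].
  by rewrite scale0r mul0r sublinear0.
apply/eqP; rewrite eq_le pS.2//= mulrC -ler_pdivlMr// mulrC.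
have := pS.2 a^-1 (a *: x); rewrite invr_gt0 => /(_ a0).
by rewrite scalerA mulVf ?gt_eqF// scale1r.
Qed.

Lemma sublinear_ge p x : sublinear p -> - p (- x) <= p x.
Proof. by move=> pS; have := pS.1 x (- x); rewrite subrr sublinear0//; lra. Qed.

(** q x is the infimum over t >= 0 of p (x + t x0) - t p x0; t = 0 and t = 1 give the two bounds. *)
Lemma sublinear_tilt p x0 : sublinear p ->
  exists q, [/\ sublinear q, forall x, q x <= p x & q (- x0) <= - p x0].
Proof.
move=> pS; pose A x := [set p (x + t *: x0) - t * p x0 | t in [set t : R | 0 <= t]].
have lbA x : lbound (A x) (- p (- x)).
  move=> _ [t t0 <-]; rewrite -(sublinearZ x0 pS t0).
  by have := pS.1 (x + t *: x0) (- x); rewrite addrAC subrr add0r; lra.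
have infle x t : 0 <= t -> inf (A x) <= p (x + t *: x0) - t * p x0.
  by move=> t0; apply: ge_inf; [exists (- p (- x)); exact: lbA|exists t].
have infge x c : (forall t, 0 <= t -> c <= p (x + t *: x0) - t * p x0) -> c <= inf (A x).
  move=> H; apply: lb_le_inf; last by move=> _ [t t0 <-]; exact: H.
  by exists (p (x + 0 *: x0) - 0 * p x0), 0 => //=.
exists (fun x => inf (A x)); split; first split.
- move=> x y /=; rewrite -lerBlDr; apply: (infge) => t t0.
  rewrite lerBlDl -lerBlDr; apply: (infge) => s s0; rewrite lerBlDr.
  apply: le_trans (infle _ (s + t) _) _; first exact: addr_ge0.
  have := pS.1 (x + t *: x0) (y + s *: x0).
  by rewrite addrACA -scalerDl (addrC t s); lra.
- move=> a x a0 /=; rewrite mulrC -ler_pdivrMr//; apply: (infge) => t t0.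
  rewrite ler_pdivrMr//; apply: le_trans (infle _ (a * t) _) _.
    by rewrite mulr_ge0// ltW.
  by rewrite -scalerA -scalerDr (sublinearZ _ pS (ltW a0)); lra.
- by move=> x; have := infle x 0 (lexx 0); rewrite scale0r mul0r addr0 subr0.
- by have := infle (- x0) 1 ler01; rewrite scale1r addNr sublinear0// mul1r sub0r.
Qed.

(* Zorn gives a minimal sublinear functional below p; by minimality it equals
   all its tilts, which forces it to be odd, hence linear. *)
Lemma hahn_banach p : sublinear p -> exists f : V -> R,
  (forall a x y, f (a *: x + y) = a * f x + f y) /\ forall x, f x <= p x.
Proof.
move=> pS.
pose T := {q : V -> R | sublinear q /\ forall x, q x <= p x}.
(* The order is reversed: a maximal element is a pointwise minimal functional. *)
pose r (q q' : T) := `[< forall x, sval q' x <= sval q x >].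
have [||||[f [fS fp]] fmin] := @Zorn T r.
- by move=> q; apply/asboolP.
- move=> q1 q2 q3 /asboolP h1 /asboolP h2; apply/asboolP => x.
  exact: le_trans (h2 x) (h1 x).
- move=> [q1 Q1] [q2 Q2] /asboolP/= h1 /asboolP/= h2.
  have E : q1 = q2 by apply/funext => x; apply/eqP; rewrite eq_le h1 h2.
  by subst q2; congr exist; exact: Prop_irrelevance.
- move=> A Atot; have [[q0 Aq0]|A0] := pselect (A !=set0); last first.
    exists (exist _ p (conj pS (fun x => lexx (p x)))) => q Aq.
    by case: A0; exists q.
  pose Q x := [set sval q x | q in A].
  have lbQ x : lbound (Q x) (- p (- x)).
    move=> _ [q Aq <-]; apply: le_trans (sublinear_ge x (svalP q).1).
    by rewrite lerN2; exact: (svalP q).2.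
  have infle x q : A q -> inf (Q x) <= sval q x.
    by move=> Aq; apply: ge_inf; [exists (- p (- x)); exact: lbQ|exists q].
  have infge x c : (forall q, A q -> c <= sval q x) -> c <= inf (Q x).
    move=> H; apply: lb_le_inf; last by move=> _ [q Aq <-]; exact: H.
    by exists (sval q0 x), q0.
  have mS : sublinear (fun x => inf (Q x)) /\ forall x, inf (Q x) <= p x.
    split; last by move=> x; apply: le_trans (infle x q0 Aq0) ((svalP q0).2 x).
    split=> [x y|a x a0].
      rewrite -lerBlDr; apply: (infge) => q Aq.
      rewrite lerBlDl -lerBlDr; apply: (infge) => q' Aq'; rewrite lerBlDr.
      (* The smaller of two members of the chain serves for both arguments. *)
      have [/asboolP h|/asboolP h] := Atot q q' Aq Aq'.
        apply: le_trans (infle _ _ Aq') _; apply: le_trans ((svalP q').1.1 _ _) _.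
        by rewrite addrC lerD2l.
      apply: le_trans (infle _ _ Aq) _; apply: le_trans ((svalP q).1.1 _ _) _.
      by rewrite addrC lerD2r.
    rewrite mulrC -ler_pdivrMr//; apply: (infge) => q Aq.
    rewrite ler_pdivrMr//; apply: le_trans (infle _ _ Aq) _.
    by rewrite mulrC; exact: (svalP q).1.2.
  exists (exist _ (fun x => inf (Q x)) mS) => q Aq; apply/asboolP => x; exact: infle.
have fN x : f (- x) = - f x.
  apply/eqP; rewrite eq_le; apply/andP; split; last first.
    by have := sublinear_ge (- x) fS; rewrite opprK.
  (* By minimality the tilt at x is f itself, whence f (- x) <= - f x. *)
  have [q [qS qf qx]] := sublinear_tilt x fS.
  have qp y : q y <= p y by exact: le_trans (qf y) (fp y).
  have := fmin (exist _ q (conj qS qp)) (asboolT qf).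
  by move=> /(congr1 sval)/= E; rewrite E in qx.
have fZ a x : f (a *: x) = a * f x.
  have [a0|a0] := leP 0 a; first exact: sublinearZ.
  by rewrite -(opprK a) scaleNr fN sublinearZ ?mulNr// oppr_ge0 ltW.
exists f; split=> // a x y; rewrite -fZ; apply/eqP; rewrite eq_le fS.1/=.
(* Oddness turns subadditivity into superadditivity. *)
have := fS.1 (- (a *: x)) (- y); rewrite -opprD !fN; lra.
Qed.

End HahnBanach.

(** A cluster point of the filter generated by the finite subfamilies lies in every C i. *)
Lemma compact_closed_family (T : topologicalType) (K : set T) (I : eqType)
    (D : set I) (C : I -> set T) :
  compact K -> (forall i, D i -> closed (C i)) ->
  (forall l : seq I, (forall i, i \in l -> D i) ->
     exists2 y, K y & forall i, i \in l -> C i y) ->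
  exists2 y, K y & forall i, D i -> C i y.
Proof.
move=> kK Ccl fin.
pose F := filter_from [set l : seq I | forall i, i \in l -> D i]
  (fun l => [set y | K y /\ forall i, i \in l -> C i y]).
have FF : ProperFilter F.
  apply: filter_from_proper; last by move=> l /fin[y Ky Cy]; exists y.
  apply: filter_from_filter; first by exists [::].
  move=> l1 l2 D1 D2; exists (l1 ++ l2).
    by move=> i; rewrite mem_cat => /orP[/D1|/D2].
  by move=> y [Ky Cy]; split; split=> // i il; apply: Cy; rewrite mem_cat il ?orbT.
have [|y [Ky yF]] := kK F FF; first by exists [::] => // y [].
exists y => // i Di; apply: Ccl => // U yU.
apply: yF => //; exists [:: i] => [j|z [_ zi]]; first by rewrite inE => /eqP ->.
by apply: zi; exact: mem_head.
Qed.

(** * The dual space as a module *)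

Section Dual.
Context {R : realType} {E : normedModType R}.

(** [R^o] is R as a module over itself, which makes the functions a module. *)
Definition dual_pred : {pred (E -> R^o)} := fun f => `[< is_dual f >].

Lemma dual_submod_closed : submod_closed dual_pred.
Proof.
split.
  apply/asboolP; split=> [a x y|]; first by rewrite mulr0 addr0.
  exact: cst_continuous.
move=> a f g /asboolP[fl fc] /asboolP[gl gc]; apply/asboolP; split=> [b x y|x].
  by rewrite !fctE fl gl /GRing.scale/=; ring.
apply: (@continuousD _ _ _ (a \*: (f : E -> R^o)) g) (gc x).
exact: (@continuousZr _ _ _ (f : E -> R^o)) (fc x).
Qed.

HB.instance Definition _ := GRing.isSubmodClosed.Build R (E -> R^o) dual_pred
  dual_submod_closed.

Definition dual := {f : E -> R^o | f \in dual_pred}.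
HB.instance Definition _ := SubChoice.copy dual {f : E -> R^o | f \in dual_pred}.
HB.instance Definition _ := [SubChoice_isSubLmodule of dual by <:].

Definition mk_dual (f : E -> R) (fd : is_dual f) : dual :=
  exist _ (f : E -> R^o) (asboolT fd).

Lemma dualP (f : dual) : is_dual (val f : E -> R).
Proof. by case: f => f /= /asboolP. Qed.
End Dual.

(** * The dual norm, the two pairings and their compact sets *)

Section DualNorm.
Context {R : realType} {E : normedModType R}.
Implicit Types f g : E -> R.

Lemma is_dualZ f a x : is_dual f -> f (a *: x) = a * f x.
Proof.
move=> [fl _]; have f0 : f 0 = 0.
  by have := fl 1 0 0; rewrite scale1r addr0 mul1r; lra.
by have := fl a x 0; rewrite !addr0 f0 addr0.
Qed.

(** Continuity at 0 gives |f| < 1 on a ball of radius d; scaling by d / 2 gives the bound 2 / d. *)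
Lemma is_dual_bounded f : is_dual f ->
  exists M, forall x, `|x| <= 1 -> `|f x| <= M.
Proof.
move=> fd; have f0 : f 0 = 0 by rewrite -(scale0r 0) is_dualZ// mul0r.
have /cvgrPdist_lt/(_ 1 ltr01) := fd.2 0.
move=> /nbhs_normP[d /= d0 dP].
exists (2 / d) => x x1.
have : `|f ((d / 2) *: x)| < 1.
  rewrite -normrN -[- _]add0r -{1}f0; apply: dP => /=.
  rewrite sub0r normrN normrZ gtr0_norm ?divr_gt0//.
  by have := normr_ge0 x; nra.
rewrite is_dualZ// normrM gtr0_norm ?divr_gt0// => H.
by rewrite ler_pdivlMr//; lra.
Qed.

Lemma dnorm_has_sup f : is_dual f -> has_sup [set `|f x| | x in [set x : E | `|x| <= 1]].
Proof.
move=> fd; split; first by exists `|f 0|, 0 => //=; rewrite normr0 ler01.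
by have [M MP] := is_dual_bounded fd; exists M => _ [x x1 <-]; exact: MP.
Qed.

Lemma dnorm_ub f x : is_dual f -> `|x| <= 1 -> `|f x| <= dnorm f.
Proof. by move=> fd x1; apply: ub_le_sup; [exact: (dnorm_has_sup fd).2|exists x]. Qed.

Lemma dnorm_lub f M : (forall x, `|x| <= 1 -> `|f x| <= M) -> dnorm f <= M.
Proof.
move=> H; apply: ge_sup; first by exists `|f 0|, 0 => //=; rewrite normr0 ler01.
by move=> _ [x x1 <-]; exact: H.
Qed.

Lemma dnorm_le f x : is_dual f -> `|f x| <= dnorm f * `|x|.
Proof.
move=> fd; have [->|x0] := eqVneq x 0.
  by rewrite -(scale0r 0) is_dualZ// mul0r !normr0 scale0r normr0 mulr0.
have nx : 0 < `|x| by rewrite normr_gt0.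
rewrite -ler_pdivrMr//.
have -> : `|f x| / `|x| = `|f (`|x|^-1 *: x)|.
  by rewrite is_dualZ// normrM normfV normr_id mulrC.
by apply: dnorm_ub => //; rewrite normrZ normfV normr_id mulVf ?gt_eqF.
Qed.

Lemma dnormD f g : is_dual f -> is_dual g -> dnorm (f + g) <= dnorm f + dnorm g.
Proof.
move=> fd gd; apply: dnorm_lub => x x1; rewrite fctE.
by apply: le_trans (ler_normD _ _) _; rewrite lerD// dnorm_ub.
Qed.

Lemma dnormZ_le f a : is_dual f -> dnorm (fun x => a * f x) <= `|a| * dnorm f.
Proof.
move=> fd; apply: dnorm_lub => x x1.
by rewrite normrM ler_wpM2l// dnorm_ub.
Qed.

Lemma is_dualZfun f a : is_dual f -> is_dual (fun x => a * f x).
Proof. by move=> fd; exact: (dualP (a *: mk_dual fd)). Qed.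

Lemma dnormZ f a : is_dual f -> dnorm (fun x => a * f x) = `|a| * dnorm f.
Proof.
move=> fd; apply/eqP; rewrite eq_le dnormZ_le//=.
have [->|a0] := eqVneq a 0.
  rewrite normr0 mul0r; apply: le_trans (dnorm_ub (x := 0) _ _) => //.
    exact: is_dualZfun.
  by rewrite normr0.
rewrite mulrC -ler_pdivlMr ?normr_gt0//.
have := dnormZ_le a^-1 (is_dualZfun a fd); rewrite normfV mulrC.
by under eq_fun do rewrite mulKf//.
Qed.

Lemma dnorm_norming f M : is_dual f -> M < dnorm f ->
  exists2 x, `|x| <= 1 & M < f x.
Proof.
move=> fd Mf; have [_ [x /= x1 <-] Mx] := sup_gt (dnorm_has_sup fd).1 Mf.
have [fx|fx] := leP 0 (f x).
  by exists x => //; rewrite -(ger0_norm fx).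
exists (- x); rewrite ?normrN//.
by rewrite -scaleN1r is_dualZ// mulN1r -(ltr0_norm fx).
Qed.

(** A linear f below the tilt of the norm at x0 has f (- x0) <= - |x0|. *)
Lemma norming_functional (x0 : E) :
  exists f : E -> R, [/\ is_dual f, dnorm f <= 1 & `|x0| <= f x0].
Proof.
have nS : sublinear (fun x : E => `|x|).
  by split=> [x y|a x a0]; [exact: ler_normD|rewrite normrZ gtr0_norm].
have [q [qS qn qx]] := sublinear_tilt x0 nS.
have [f [fl fq]] := hahn_banach qS.
have f0 : f 0 = 0 by have := fl 1 0 0; rewrite scale1r addr0 mul1r; lra.
have fN x : f (- x) = - f x by have := fl (-1) x 0; rewrite f0 !addr0 scaleN1r mulN1r.
have fn x : `|f x| <= `|x|.
  rewrite ler_norml (le_trans (fq x) (qn x)) andbT.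
  by have := le_trans (fq (- x)) (qn (- x)); rewrite fN normrN; lra.
have fd : is_dual f.
  split=> // x; apply/cvgrPdist_lt => e e0.
  apply/nbhs_normP; exists e => //= y xy.
  have -> : f x - f y = f (x - y) by rewrite -(scaleN1r y) (addrC x) fl; lra.
  exact: le_lt_trans (fn _) xy.
exists f; split=> //.
  by apply: dnorm_lub => x x1; apply: le_trans (fn x) x1.
by have := le_trans (fq (- x0)) qx; rewrite fN; lra.
Qed.

Lemma val_dual_linear (f g : dual (E := E)) a x :
  val (a *: f + g) x = a * val f x + val g x.
Proof. by []. Qed.

(** Used for (i); the dual norm is norming by its definition. *)
Definition evaluation_pairing : @normed_pairing R E (dual (E := E)).
Proof.
refine (@NormedPairing R E (dual (E := E)) (fun x => `|x|)
  (fun phi => dnorm (val phi : E -> R)) (fun x phi => val phi x) _ _ _ _ _ _ _ _).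
- exact: ler_normD.
- by move=> a x; rewrite normrZ.
- by move=> f g; exact: dnormD (dualP f) (dualP g).
- by move=> a f; exact: dnormZ a (dualP f).
- by move=> a x x' f; exact: (dualP f).1.
- by move=> a x f g; exact: val_dual_linear.
- by move=> x f; rewrite mulrC; exact: dnorm_le (dualP f).
- by move=> f M Mf; exact: dnorm_norming (dualP f) Mf.
Defined.

(** Used for (ii); here the norming property rests on Hahn-Banach. *)
Definition coevaluation_pairing : @normed_pairing R (dual (E := E)) E.
Proof.
refine (@NormedPairing R (dual (E := E)) E (fun phi => dnorm (val phi : E -> R))
  (fun x => `|x|) (fun phi x => val phi x) _ _ _ _ _ _ _ _).
- by move=> f g; exact: dnormD (dualP f) (dualP g).
- by move=> a f; exact: dnormZ a (dualP f).
- exact: ler_normD.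
- by move=> a x; rewrite normrZ.
- by move=> a f g x; exact: val_dual_linear.
- by move=> a f x x'; exact: (dualP f).1.
- by move=> f x; exact: dnorm_le (dualP f).
- move=> x M Mx; have [f [fd f1 fx]] := norming_functional x.
  by exists (mk_dual fd) => //; exact: lt_le_trans Mx fx.
Defined.

(** Evaluation at a point is continuous for pointwise convergence, so half-spaces are closed. *)
Lemma weakstar_halfspace_compact (W : set (E -> R)) :
  (forall f, W f -> is_dual f) -> weakstar_compact W ->
  halfspace_compact evaluation_pairing [set phi | W (val phi : E -> R)].
Proof.
move=> Wd kW A fin.
have [|l lA|f Wf fA] := @compact_closed_family {ptws E -> R} W _ A
  (fun p => [set f : E -> R | p.2 <= f p.1]) kW.
- move=> p _; apply: (@closed_comp {ptws E -> R} R (fun f => f p.1) [set r | p.2 <= r]).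
    by move=> f _; exact: (@proj_continuous E (fun=> R) p.1).
  exact: closed_ge.
- by have [f Wf fl] := fin l lA; exists (val f : E -> R).
- by exists (mk_dual (Wd _ Wf)).
Qed.

Lemma weakly_halfspace_compact (W : set E) :
  weakly_compact W -> halfspace_compact coevaluation_pairing W.
Proof.
move=> kW A fin.
have [|l lA|x Wx xA] := @compact_closed_family (@weak_top R E) W _ A
  (fun p => [set x : E | p.2 <= val p.1 x]) kW.
- move=> p _.
  apply: (@closed_comp (@weak_top R E) R (fun x => val p.1 x) [set r | p.2 <= r]).
    move=> x _.
    (* The weak topology is initial for [ev]; a functional is [ev] followed by a coordinate
       projection. *)
    pose ev (x : E) : {ptws @dualT R E -> R} := fun phi => sval phi x.
    pose psi : @dualT R E := exist _ _ (dualP p.1).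
    apply: (@continuous_comp (@weak_top R E) {ptws @dualT R E -> R} R ev (fun h => h psi)).
      exact: initial_continuous.
    exact: (@proj_continuous {classic @dualT R E} (fun=> R) psi).
  exact: closed_ge.
- by have [x Wx xl] := fin l lA; exists x.
- by exists x.
Qed.

End DualNorm.

(** * Quasidensity and closedness in terms of [dual] *)

Section QuasidenseGraph.
Context {R : realType} {E : normedModType R} (S : E -> set (E -> R)).

Lemma quasidense_near : into_dual S -> mf_quasidense S ->
  forall x (phi : dual (E := E)) (e : R), 0 < e -> exists s (psi : dual (E := E)),
  S s (val psi) /\ 2^-1 * `|s - x| ^+ 2 + 2^-1 * dnorm (val (psi - phi) : E -> R) ^+ 2
    + val (psi - phi) (s - x) < e.
Proof.
move=> Sd Sq x phi e e0.
have /ereal_inf_lt[_ [[s ss] /= Sss <-]] :=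
  le_lt_trans (Sq x _ (dualP phi)) (e0 : (0 < e%:E)%E).
by rewrite lte_fin => H; exists s, (mk_dual (Sd _ _ Sss)).
Qed.

Lemma closed_near : mf_closed S -> forall x (phi : dual (E := E)),
  (forall e : R, 0 < e -> exists s (psi : dual (E := E)),
     [/\ S s (val psi), `|s - x| < e & dnorm (val (psi - phi) : E -> R) < e]) ->
  S x (val phi).
Proof.
move=> Sc x phi H; apply: Sc => [|e e0]; first exact: dualP.
by have [s [psi [? ? ?]]] := H e e0; exists s, (val psi).
Qed.

End QuasidenseGraph.

Unset Implicit Arguments.

Theorem theorem6p5 (R : realType) (E : completeNormedModType R)
  (S : E -> set (E -> R)) :
  (exists x : E, x != 0) ->
  into_dual S -> graph S !=set0 ->
  mf_closed S -> mf_monotone S -> mf_quasidense S ->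
  (forall (w : E) (Wt : set (E -> R)),
      Wt !=set0 -> (forall xs, Wt xs -> is_dual xs) ->
      weakstar_compact Wt -> convex_dual Wt ->
      (forall s ss, S s ss -> exists2 xs, Wt xs & 0 <= ss (s - w) - xs (s - w)) ->
      exists2 xs, S w xs & Wt xs)
  /\
  (forall (W : set E) (ws : E -> R),
      W !=set0 -> weakly_compact W -> convexE W -> is_dual ws ->
      (forall s ss, S s ss -> exists2 x, W x & 0 <= ss (s - x) - ws (s - x)) ->
      exists2 x, W x & S x ws).
Proof.
move=> _ Sd _ Sc Sm Sq; split=> [w Wt [f0 Wf0] Wd kW cW GW|W ws W0 kW cW wsd GW].
- have [|||||||phi Wphi Sphi] :=
    @graph_meets R E (dual (E := E)) (evaluation_pairing (E := E))
    (fun x phi => S x (val phi)) _ _ _ w [set phi | Wt (val phi : E -> R)].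
  + by move=> s psi t chi Ss St; exact: Sm Ss St.
  + exact: quasidense_near.
  + exact: closed_near.
  + by exists (mk_dual (Wd _ Wf0)).
  + exact: weakstar_halfspace_compact.
  + by move=> phi psi Wphi Wpsi t t01; exact: cW.
  + move=> s psi Ss; have [xs Wxs le0] := GW _ _ Ss.
    by exists (mk_dual (Wd _ Wxs)).
  + by exists (val phi).
(* The graph is transposed: the dual becomes the first space and E the second. *)
- have [|||||||x Wx Sx] :=
    @graph_meets R (dual (E := E)) E (coevaluation_pairing (E := E))
    (fun phi x => S x (val phi)) _ _ _ (mk_dual wsd) W.
  + by move=> psi s chi t Ss St; exact: Sm Ss St.
  + move=> phi x e e0; have [s [psi [Ss lt]]] := quasidense_near Sd Sq x phi e0.
    by exists psi, s; split=> //=; rewrite (addrC (_ * dnorm _ ^+ 2)).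
  + move=> phi x H; apply: closed_near => // e e0.
    by have [psi [s [Ss h1 h2]]] := H e e0; exists s, psi.
  + by [].
  + exact: weakly_halfspace_compact.
  + by move=> a b Wa Wb t t01; exact: cW.
  + by move=> psi s Ss; exact: GW Ss.
  + by exists x.
Qed.
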